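(* Let $X$ be a uniformly convex Banach space, let $C=\bigcup_{k=1}^{p}C_k$ be a union of nonempty closed convex subsets $C_k$ of $X$ ($p\ge1$ an integer), and let $T:C\to C$ be $\lambda$-firmly nonexpansive for some $\lambda\in(0,1)$. Then $T$ has fixed points if and only if $T$ has bounded orbits.
   Context: For a subset $C$ of a Banach space $X$ and $\lambda\in(0,1)$, a map $T:C\to X$ is $\lambda$-firmly nonexpansive if $\|Tx-Ty\|\le\|(1-\lambda)(x-y)+\lambda(Tx-Ty)\|$ for all $x,y\in C$. Such a map is nonexpansive, i.e. $\|Tx-Ty\|\le\|x-y\|$ for all $x,y\in C$. For a nonexpansive $T:C\to C$, the orbit of $x\in C$ is $\{T^nx\mid n=0,1,2,\ldots\}$; $T$ has bounded orbits if the orbit of some (equivalently, every) $x\in C$ is bounded. *)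

(* Defs.v *)
From mathcomp Require Import all_boot all_order all_algebra.
From mathcomp Require Import all_classical all_reals all_analysis.

Set Implicit Arguments.
Unset Strict Implicit.
Unset Printing Implicit Defensive.

Import Order.TTheory GRing.Theory Num.Theory.
Import numFieldNormedType.Exports.

Local Open Scope classical_set_scope.
Local Open Scope ring_scope.

Definition uniformly_convex (R : realType) (X : normedModType R) : Prop :=
  forall eps : R, 0 < eps <= 2 ->
    exists2 delta : R, 0 < delta &
      forall x y : X, `|x| <= 1 -> `|y| <= 1 -> eps <= `|x - y| ->
        `|2^-1 *: (x + y)| <= 1 - delta.

(* A map C -> X is represented by a total map X -> X of which only the values
   on C matter; for a map C -> C one adds [set_fun C C T]. *)
Definition firmly_nonexpansive (R : realType) (X : normedModType R)
    (lambda : R) (C : set X) (T : X -> X) : Prop :=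
  forall x y, C x -> C y ->
    `|T x - T y| <= `|(1 - lambda) *: (x - y) + lambda *: (T x - T y)|.

Definition nonexpansive (R : realType) (X : normedModType R)
    (C : set X) (T : X -> X) : Prop :=
  forall x y, C x -> C y -> `|T x - T y| <= `|x - y|.

Definition orbit (X : Type) (T : X -> X) (x : X) : set X :=
  range (fun n : nat => iter n T x).

(* For a nonexpansive self-map of C it does not matter which point of C is
   taken: see [bounded_orbits_all] below. *)
Definition bounded_orbits (R : realType) (X : normedModType R)
    (C : set X) (T : X -> X) : Prop :=
  exists2 x, C x & [bounded z | z in orbit T x].

Definition has_fixed_point (X : Type) (C : set X) (T : X -> X) : Prop :=
  exists2 x, C x & T x = x.

Lemma firmly_nonexpansive_nonexpansive (R : realType) (X : normedModType R)
    (lambda : R) (C : set X) (T : X -> X) :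
  0 < lambda < 1 -> firmly_nonexpansive lambda C T -> nonexpansive C T.
Proof.
move=> /andP[l0 l1] fT x y Cx Cy.
have l1' : 0 < 1 - lambda by rewrite subr_gt0.
have := le_trans (fT x y Cx Cy) (ler_normD _ _).
rewrite !normrZ (gtr0_norm l0) (gtr0_norm l1') -lerBlDr.
by rewrite -[X in X - _]mul1r -mulrBl ler_pM2l.
Qed.

Lemma bounded_orbits_all (R : realType) (X : normedModType R)
    (C : set X) (T : X -> X) :
  set_fun C C T -> nonexpansive C T -> bounded_orbits C T ->
  forall y, C y -> [bounded z | z in orbit T y].
Proof.
move=> CT nT [x Cx [M [Mr HM]]] y Cy.
have Ci z n : C z -> C (iter n T z) by move=> Cz; elim: n => //= n; exact: CT.
have d n : `|iter n T y - iter n T x| <= `|y - x|.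
  by elim: n => //= n; apply: le_trans; apply: nT; exact: Ci.
exists (`|y - x| + (M + 1)); split; first exact: num_real.
move=> N MN z [n _ <-] /=; apply: le_trans (ltW MN).
rewrite -[X in `|X|](subrK (iter n T x)).
apply: le_trans (ler_normD _ _) _; apply: lerD => //.
by apply: (HM (M + 1)); [rewrite ltrDl | exists n].
Qed.

(* Main.v *)
Require Import Defs.
From mathcomp Require Import all_boot all_order all_algebra.
From mathcomp Require Import all_classical all_reals all_analysis.
From mathcomp Require Import lra.

Import Order.TTheory GRing.Theory Num.Theory.
Import numFieldNormedType.Exports.

Local Open Scope classical_set_scope.
Local Open Scope ring_scope.

(* The asymptotic center of a bounded orbit in each closed convex piece C_k
   exists and is unique by uniform convexity. Since the asymptotic distance to
   the orbit does not increase under T, T maps the centers of minimal radius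
   into the finite set of these centers, so one of them is periodic; and by
   strict convexity a periodic point of a firmly nonexpansive map is fixed. *)

(** * Uniform convexity on balls of varying radius *)

Lemma convex_set_midpoint (R : realType) (X : lmodType R) (A : set X)
    (x y : X) :
  convex_set A -> A x -> A y -> A (2^-1 *: (x + y)).
Proof.
move=> cA Ax Ay.
have h1 : (2^-1 : R) <= 1 by lra.
have h0 : 0 <= (2^-1 : R) by lra.
have := cA x y (Itv01 h0 h1); rewrite !inE => /(_ Ax Ay).
suff -> : conv (Itv01 h0 h1) (x : convex_lmodType X) y = 2^-1 *: (x + y) by [].
rewrite scalerDr; congr (_ + _ *: _).
by rewrite /= /unstable.onem; lra.
Qed.

(** Rescaling by [s^-1] turns the separation [eps] into [eps / s], which is at least [eps / M];
    hence a single [delta] serves all radii up to [M]. *)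
Lemma uniformly_convex_midpoint (R : realType) (X : normedModType R)
    (eps M : R) : uniformly_convex X -> 0 < eps -> 0 < M ->
  exists2 delta : R, 0 < delta &
    forall (s : R) (x y : X), 0 < s <= M -> `|x| <= s -> `|y| <= s ->
      eps <= `|x - y| -> `|2^-1 *: (x + y)| <= s * (1 - delta).
Proof.
move=> uc e0 M0.
(* The minimum with 2 keeps the separation in the range where the modulus is defined. *)
have [|delta d0 Hd] := uc (Num.min (eps / M) 2).
  by rewrite lt_min divr_gt0//= ltr0n ge_min lexx orbT.
exists delta => // s x y /andP[s0 sM] xs ys exy.
have nz (z : X) : `|s^-1 *: z| = `|z| / s.
  by rewrite normrZ gtr0_norm ?invr_gt0// mulrC.
have := Hd (s^-1 *: x) (s^-1 *: y).
rewrite -scalerBr -scalerDr scalerA [2^-1 * _]mulrC -scalerA.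
rewrite !nz !ler_pdivrMr ?mul1r//.
rewrite [s * _]mulrC; apply => //.
rewrite ge_min; apply/orP; left.
apply: (@le_trans _ _ (eps / s)); last by rewrite ler_pM2r ?invr_gt0.
by rewrite ler_pM2l// lef_pV2.
Qed.

(** By symmetry [l <= 1/2], so the combination lies between [a] and the midpoint, with weights
    [1 - 2 * l] and [2 * l]. If [a] and [b] differed, the midpoint would have norm strictly below
    [d], and so would the combination. *)
Lemma uniformly_convex_strict (R : realType) (X : normedModType R)
    (d l : R) (a b : X) :
  uniformly_convex X -> 0 < l < 1 -> `|a| <= d -> `|b| <= d ->
  d <= `|(1 - l) *: a + l *: b| -> a = b.
Proof.
move=> uc.
wlog l2 : l a b / l <= 2^-1.
  move=> wl l01 ad bd dab; have [/wl|/ltW l2] := leP l 2^-1; first exact.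
  apply/esym/(wl (1 - l)) => //; first by lra.
    by move: l01 => /andP[? ?]; apply/andP; split; lra.
  by rewrite subKr addrC.
move=> /andP[l0 l1] ad bd dab.
apply/eqP; rewrite -subr_eq0 -normr_le0 leNgt; apply/negP => ab0.
have d0 : 0 < d.
  rewrite lt_neqAle (le_trans _ ad)// andbT; apply: contraTneq ab0 => d0.
  move: ad bd; rewrite -d0 !normr_le0 => /eqP-> /eqP->.
  by rewrite subrr normr0 ltxx.
have [delta delta0 /(_ d a b)] := @uniformly_convex_midpoint R X _ _ uc ab0 d0.
rewrite d0 lexx => /(_ isT ad bd (lexx _)) mid.
have : `|(1 - l) *: a + l *: b| <=
    (1 - 2 * l) * `|a| + 2 * l * `|2^-1 *: (a + b)|.
  have -> : (1 - l) *: a + l *: b =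
      (1 - 2 * l) *: a + (2 * l) *: (2^-1 *: (a + b)).
    rewrite scalerA -[2 * l * _]mulrC mulKf// scalerDr addrA -scalerDl.
    by congr (_ *: _ + _); lra.
  apply: le_trans (ler_normD _ _) _.
  by rewrite (normrZ (1 - _)) (normrZ (2 * l)) !ger0_norm //; lra.
have : (1 - 2 * l) * `|a| <= (1 - 2 * l) * d by apply: ler_wpM2l => //; lra.
have : 2 * l * `|2^-1 *: (a + b)| <= 2 * l * (d * (1 - delta)).
  by apply: ler_wpM2l => //; lra.
have : 0 < l * (d * delta) by rewrite !mulr_gt0.
by move: dab; lra.
Qed.

(** * Periodic points and eventually periodic orbits *)

Section PeriodicPoints.
Context {R : realType} {X : normedModType R} (C : set X) (T : X -> X).
Hypothesis T_self : set_fun C C T.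

Lemma iter_self n x : C x -> C (iter n T x).
Proof. by move=> Cx; elim: n => //= n; exact: T_self. Qed.

Lemma nonexpansive_iter n x y : nonexpansive C T -> C x -> C y ->
  `|iter n T x - iter n T y| <= `|x - y|.
Proof.
move=> nT Cx Cy; elim: n => //= n; apply: le_trans.
by apply: nT; exact: iter_self.
Qed.

(* The displacements [T^(n+1) u - T^n u] all have the same norm, so by strict
   convexity firm nonexpansiveness makes them equal; they sum to 0. *)
Lemma firmly_nonexpansive_periodic (lambda : R) (m : nat) (u : X) :
  uniformly_convex X -> 0 < lambda < 1 -> firmly_nonexpansive lambda C T ->
  C u -> iter m.+1 T u = u -> T u = u.
Proof.
move=> uc l01 fT Cu um.
have nT := firmly_nonexpansive_nonexpansive l01 fT.
have step w : C w -> iter m.+1 T w = w -> T (T w) - T w = T w - w.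
  move=> Cw wm; apply/esym.
  have CTw := T_self _ Cw.
  have wTw : `|T w - w| <= `|T (T w) - T w|.
    (* Periodicity reverses nonexpansiveness: [T w - w] is also the difference of the [m]-th
       iterates of [T (T w)] and [T w]. *)
    rewrite -{1 2}wm -iterS !iterSr.
    by apply: nonexpansive_iter => //; exact: T_self.
  have := fT _ _ CTw Cw.
  move/(le_trans wTw).
  by apply: (@uniformly_convex_strict _ _ `|T w - w|) => //; exact: nT.
have displ n : iter n.+1 T u - iter n T u = T u - u.
  elim: n => // n <-; apply: step; first exact: iter_self.
  by rewrite -iterD addnC iterD um.
have arith n : iter n T u = u + (T u - u) *+ n.
  elim: n => [|n IH]; first by rewrite addr0.
  by rewrite mulrS addrCA -IH -(displ n) subrK.
have /eqP := arith m.+1; rewrite um -[X in X == _]addr0 eq_sym.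
rewrite (inj_eq (addrI _)) -scaler_nat scaler_eq0 pnatr_eq0 /= subr_eq0.
by move/eqP.
Qed.

End PeriodicPoints.

(** Pigeonhole: the first [(size s).+1] iterates cannot be pairwise distinct. *)
Lemma finite_orbit_periodic (X : eqType) (T : X -> X) (s : seq X) (x : X) :
  (forall n, iter n T x \in s) ->
  exists n m, iter m.+1 T (iter n T x) = iter n T x.
Proof.
move=> Ts; apply: contrapT => nper.
pose t := [seq iter n T x | n <- iota 0 (size s).+1].
suff /uniq_leq_size /(_ (_ : {subset t <= s})) : uniq t.
  rewrite size_map size_iota ltnn => H; have // : false.
  by apply: H => _ /mapP[n _ ->].
rewrite map_inj_uniq ?iota_uniq// => i j.
wlog ij : i j / (i <= j)%N.
  by move=> wl; have [/wl|/ltnW /wl H /esym/H] := leqP i j.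
move=> eij; apply/eqP; rewrite eqn_leq ij leqNgt; apply/negP => lij.
apply: nper; exists i, (j - i).-1.
by rewrite prednK ?subn_gt0// -iterD subnK.
Qed.

(** * Asymptotic centers of a bounded sequence *)

Section AsymptoticCenters.
Context {R : realType} {X : completeNormedModType R} (u : nat -> X).
Hypothesis X_uc : uniformly_convex X.
Hypothesis u_bounded : exists M : R, forall n, `|u n| <= M.
Implicit Types (A : set X) (s : R).

Definition eventually_within y s := \forall n \near \oo, `|u n - y| <= s.

(* Infimum over [y] in [A] of the asymptotic distance
   [limsup_n `|u n - y|]. *)
Definition asymptotic_radius A :=
  inf [set s | exists2 y, A y & eventually_within y s].

(** Only [s] strictly above the radius is tested, since the terms may approach the limsup from above
    without ever reaching it. *)
Definition asymptotic_center A y :=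
  A y /\ forall s, asymptotic_radius A < s -> eventually_within y s.

Lemma eventually_within_ge0 y s : eventually_within y s -> 0 <= s.
Proof. by move=> [N _ /(_ N (leqnn _))] /=; exact: le_trans. Qed.

Lemma eventually_within_le y s s' :
  s <= s' -> eventually_within y s -> eventually_within y s'.
Proof. by move=> ss'; apply: filterS => n /le_trans; exact. Qed.

Lemma asymptotic_radius_le A y s :
  A y -> eventually_within y s -> asymptotic_radius A <= s.
Proof.
move=> Ay ys; apply: ge_inf; last by exists y.
by exists 0 => r [z _ /eventually_within_ge0].
Qed.

Lemma radii_neq0 A : A !=set0 ->
  [set s | exists2 y, A y & eventually_within y s] !=set0.
Proof.
move=> [y Ay]; have [M uM] := u_bounded.
exists (M + `|y|), y => //; apply: nearW => n.
by apply: le_trans (ler_normB _ _) _; rewrite lerD2r.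
Qed.

Lemma asymptotic_radius_ge0 A : A !=set0 -> 0 <= asymptotic_radius A.
Proof.
move=> A0; apply: lb_le_inf; first exact: radii_neq0.
by move=> r [z _ /eventually_within_ge0].
Qed.

Lemma asymptotic_radius_lt A s : A !=set0 -> asymptotic_radius A < s ->
  exists2 y, A y & eventually_within y s.
Proof.
move=> A0 /(inf_lt (radii_neq0 A A0))[r [y Ay yr] rs].
by exists y => //; apply: eventually_within_le yr; exact: ltW.
Qed.

(* If two near-minimizers were [eps] apart, their midpoint would be closer to
   the sequence than the asymptotic radius allows. *)
Lemma near_centers_close A eps : A !=set0 -> convex_set A -> 0 < eps ->
  exists2 s, asymptotic_radius A < s & forall y z, A y -> A z ->
    eventually_within y s -> eventually_within z s -> `|y - z| < eps.
Proof.
move=> A0 cA e0; set r := asymptotic_radius A.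
have r0 : 0 <= r := asymptotic_radius_ge0 A A0.
(* Radius 0 is treated apart: the gain [r * delta] would vanish, but the triangle inequality
   suffices. *)
have [r_eq0|r_neq0] := eqVneq r 0.
  exists (eps / 3); first by rewrite r_eq0 divr_gt0.
  move=> y z Ay Az ye ze.
  have [n [/= ny nz]] := filter_ex (filterI ye ze).
  by have := ler_distD (u n) y z; rewrite (distrC y (u n)); lra.
have {r_neq0}r0 : 0 < r by rewrite lt_neqAle eq_sym r_neq0.
have [|delta d0 Hd] := @uniformly_convex_midpoint R X eps (r + r) X_uc e0.
  by rewrite addr_gt0.
(* The bound [t <= r] keeps [r + t] in the range covered by [delta]; [t <= r * delta / 2] makes
   [(r + t) * (1 - delta)] smaller than [r]. *)
pose t := Num.min r (r * delta / 2).
have t0 : 0 < t by rewrite lt_min r0 divr_gt0 ?mulr_gt0.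
exists (r + t); first by rewrite ltrDl.
move=> y z Ay Az ye ze; rewrite ltNge; apply/negP => eyz.
have : r <= (r + t) * (1 - delta).
  apply: (@asymptotic_radius_le _ (2^-1 *: (y + z))).
    exact: convex_set_midpoint.
  apply: filterS2 ye ze => n ny nz.
  have -> : u n - 2^-1 *: (y + z) = 2^-1 *: ((u n - y) + (u n - z)).
    rewrite addrACA -opprD scalerBr -[u n + u n]mulr2n.
    by rewrite -[u n *+ 2]scaler_nat scalerA mulVf// scale1r.
  apply: Hd => //.
    by rewrite addr_gt0//= lerD2l ge_min lexx.
  have -> : u n - y - (u n - z) = z - y by rewrite opprB addrC addrA subrK.
  by rewrite distrC.
have : t <= r * delta / 2 by rewrite ge_min lexx orbT.
have : 0 < r * delta by rewrite mulr_gt0.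
have : 0 < t * delta by rewrite mulr_gt0.
by lra.
Qed.

Lemma asymptotic_center_unique A y z : convex_set A ->
  asymptotic_center A y -> asymptotic_center A z -> y = z.
Proof.
move=> cA [Ay yr] [Az zr]; apply/eqP.
rewrite -subr_eq0 -normr_le0 leNgt; apply/negP => yz.
have [|s rs] := @near_centers_close A _ _ cA yz; first by exists y.
by move=> /(_ y z Ay Az (yr s rs) (zr s rs)); rewrite ltxx.
Qed.

(** A minimizing sequence is Cauchy because near-minimizers are close; its limit stays in the closed
    set [A]. *)
Lemma asymptotic_center_exists A : A !=set0 -> convex_set A -> closed A ->
  exists y, asymptotic_center A y.
Proof.
move=> A0 cA clA; set r := asymptotic_radius A.
have /choice[y Hy] : forall n : nat, exists y,
    A y /\ eventually_within y (r + n.+1%:R^-1).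
  move=> n; have [|y Ay yn] := @asymptotic_radius_lt A (r + n.+1%:R^-1) A0.
    by rewrite ltrDl invr_gt0.
  by exists y.
have ev s : r < s -> \forall n \near \oo, eventually_within (y n) s.
  move=> rs; have sr : 0 < s - r by rewrite subr_gt0.
  apply: filterS (near_infty_natSinv_lt (PosNum sr)) => n /= ns.
  by apply: eventually_within_le (Hy n).2; rewrite -lerBrDl ltW.
have : cvg (y @ \oo).
  apply: cauchy_cvg; apply: cauchy_exP => e e0.
  have [s rs close] := near_centers_close A e A0 cA e0.
  have [N _ HN] := ev s rs.
  exists (y N), N => // n Nn; rewrite -ball_normE /=.
  by apply: close; [exact: (Hy _).1|exact: (Hy _).1|apply: HN|apply: HN] => /=.
rewrite cvg_ex => -[l yl]; exists l; split.
  by apply: (@closed_cvg _ _ \oo _ y A clA _ l yl); apply: nearW => n;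
    exact: (Hy n).1.
(* Half of the gap [s - r] pays for the distance from [l] to [y n], the other half for the excess of
   [y n] over the radius. *)
move=> s rs; have sr : 0 < (s - r) / 2 by rewrite divr_gt0// subr_gt0.
have r2 : r < r + (s - r) / 2 by rewrite ltrDl.
have [n [/= lyn]] := filter_ex (filterI (cvg_ball yl sr) (ev _ r2)).
apply: filterS => k; rewrite -ball_normE /= in lyn.
move=> /= uk; have := ler_distD (y n) (u k) l.
by move: lyn; rewrite (distrC l); lra.
Qed.

End AsymptoticCenters.

Theorem corollary4p2 (R : realType) (X : completeNormedModType R)
    (X_uc : uniformly_convex X)
    (p : nat) (p_ge1 : (1 <= p)%N) (C_ : 'I_p -> set X)
    (C_neq0 : forall k, C_ k !=set0)
    (C_closed : forall k, closed (C_ k))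
    (C_convex : forall k, convex_set (C_ k))
    (C : set X) (C_def : C = \bigcup_(k in [set: 'I_p]) C_ k)
    (T : X -> X) (T_self : set_fun C C T)
    (lambda : R) (lambda01 : 0 < lambda < 1)
    (T_fne : firmly_nonexpansive lambda C T) :
  has_fixed_point C T <-> bounded_orbits C T.
Proof.
have T_ne := firmly_nonexpansive_nonexpansive lambda01 T_fne.
split=> [[x Cx Tx]|[x Cx [M [_ HM]]]].
  exists x => //; exists `|x|; split; first exact: num_real.
  move=> N /ltW xN z [n _ <-] /=.
  by rewrite (_ : iter n T x = x)//; elim: n => //= n ->.
pose u n := iter n T x.
have u_bnd : exists M, forall n, `|u n| <= M.
  by exists (M + 1) => n; apply: (HM (M + 1)); [rewrite ltrDl|exists n].
have Cc k y : C_ k y -> C y by move=> Cy; rewrite C_def; exists k.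
have /choice[c Hc] : forall k, exists y, asymptotic_center u (C_ k) y.
  by move=> k; apply: asymptotic_center_exists.
pose r k := asymptotic_radius u (C_ k).
have [k0 _ k0_min] :
    exists2 k0, xpredT k0 & forall k, xpredT k -> r k0 <= r k.
  have [k0 k0T k0_min] := @arg_minP _ _ _ (Ordinal p_ge1) xpredT r isT.
  by exists k0.
have step k : r k = r k0 -> exists2 j, r j = r k0 & T (c k) = c j.
  move=> rk; have [Ckc ck_within] := Hc k.
  have T_within s : r k0 < s -> eventually_within u (T (c k)) s.
    rewrite -rk => /ck_within [N _ HN].
    (* The shift by one comes from [u n.+1 = T (u n)], which nonexpansiveness compares with
       [T (c k)]. *)
    exists N.+1 => // -[//|n] /= Nn; apply: le_trans (HN n Nn).
    by apply: T_ne; [exact: iter_self|exact: Cc Ckc].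
  have : C (T (c k)) by apply: T_self; exact: Cc Ckc.
  rewrite {1}C_def => -[j _ CjT].
  (* Minimality of [r k0] gives one inequality; the other holds because [T (c k)] is itself a
     competitor in [C_ j]. *)
  have rj : r j = r k0.
    apply: le_anti; rewrite k0_min// andbT.
    apply/ler_addgt0Pr => e e0.
    by apply: asymptotic_radius_le CjT (T_within _ _); rewrite ltrDl.
  exists j => //; apply: (asymptotic_center_unique u X_uc u_bnd (C_ j)) => //.
  by split=> // s; rewrite -/(r j) rj; exact: T_within.
have orb n : exists2 j, r j = r k0 & iter n T (c k0) = c j.
  elim: n => [|n [j rj]]; first by exists k0.
  by move=> /= ->; exact: step.
(* The orbit of [c k0] stays among the finitely many values of [c], so one of its iterates is
   periodic, hence fixed. *)
have [|n [m per]] := @finite_orbit_periodic _ T (codom c) (c k0).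
  by move=> n; have [j _ ->] := orb n; exact: codom_f.
exists (iter n T (c k0)).
  by have [j _ ->] := orb n; exact: Cc (Hc j).1.
apply: (@firmly_nonexpansive_periodic _ _ C T T_self lambda m) => //.
by have [j _ ->] := orb n; exact: Cc (Hc j).1.
Qed.
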